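(* Each unshielded Peano compactum $K\subset\mathbb{C}$ is finitely Suslinian.
   Context: A compactum is a compact metric space; a continuum is a connected compactum; a Peano continuum is a locally connected continuum. A Peano compactum is a compact metric space all of whose components are Peano continua and such that for every $C>0$ all but finitely many of its components have diameter less than $C$. A compactum $K\subset\mathbb{C}$ is unshielded if $K=\partial W$, where $W$ is the unbounded component of $\mathbb{C}\setminus K$. A compactum is finitely Suslinian if every collection of pairwise disjoint subcontinua whose diameters are bounded away from zero is finite. *)

(* Defs.v *)
From HB Require Import structures.
From mathcomp Require Import all_boot all_order all_algebra.
From mathcomp Require Import complex.
From mathcomp Require Import all_classical all_reals all_analysis.

Set Implicit Arguments.
Unset Strict Implicit.
Unset Printing Implicit Defensive.

Import Order.TTheory GRing.Theory Num.Theory.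
Import numFieldNormedType.Exports.

Local Open Scope classical_set_scope.
Local Open Scope ring_scope.

(* R[i] carries no topology by itself in MathComp-Analysis.  Seen as a
   numFieldType it receives the one defined by its norm, the complex modulus. *)
Definition Cplx (R : realType) : numFieldType := R[i].

Section compacta.
Context {R : realType}.
Implicit Types (K A W : set (Cplx R)).

(* The norm `|z| of the numFieldType R[i] is itself an element of R[i];
   Normc.normc z : R is the same modulus taken as a real number.
   diam set0 = -oo and diam A = +oo when A is unbounded. *)
Definition diam A : \bar R :=
  ereal_sup [set (Normc.normc (p.1 - p.2))%:E | p in A `*` A].

Definition boundary A : set (Cplx R) := closure A `\` interior A.

(* The relatively open subsets of A are the sets A `&` V with V open. *)
Definition locally_connected A : Prop :=
  forall x U, A x -> nbhs x U ->
    exists V, [/\ open V, V x, A `&` V `<=` U & connected (A `&` V)].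

Definition component_of A : set (set (Cplx R)) := connected_component A @` A.

Definition continuum A : Prop := compact A /\ connected A.

Definition peano_continuum A : Prop := continuum A /\ locally_connected A.

Definition peano_compactum K : Prop :=
  [/\ compact K,
      forall A, component_of K A -> peano_continuum A &
      forall C : R, 0 < C ->
        finite_set [set A | component_of K A /\ ~ (diam A < C%:E)%E]].

(* The complement of a compact set has exactly one unbounded component. *)
Definition unshielded K : Prop :=
  compact K /\
  exists W, [/\ component_of (~` K) W, ~ bounded_set W & K = boundary W].

(* The empty set is a continuum here, but is excluded by the lower bound on
   diameters. *)
Definition finitely_suslinian K : Prop :=
  compact K /\
  forall F : set (set (Cplx R)),
    (forall A, F A -> continuum A /\ A `<=` K) ->
    (forall A B, F A -> F B -> A <> B -> A `&` B = set0) ->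
    (exists2 e : R, 0 < e & forall A, F A -> (e%:E <= diam A)%E) ->
    finite_set F.

End compacta.

(* Main.v *)
Require Import Defs.
From mathcomp Require Import all_boot all_order all_algebra.
From mathcomp Require Import complex lra.
From mathcomp Require Import all_classical all_reals all_analysis.

Set Implicit Arguments.
Unset Strict Implicit.
Unset Printing Implicit Defensive.

Import Order.TTheory GRing.Theory Num.Theory.
Import numFieldNormedType.Exports.

Local Open Scope classical_set_scope.
Local Open Scope ring_scope.

(** The statement is a topological form of the fact that K_{3,3} is not planar,
    and the proof is van Kampen's mod 2 count of crossings.

    Suppose that K contains infinitely many disjoint continua of diameter at
    least e.  As K has finitely many components of diameter at least e, infinitely
    many of these continua lie in one component P.  Choosing in each of them two
    points at distance at least e / 2 and extracting a cluster point of these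
    pairs gives two points x and y of P with x <> y.  Exchanging the real and
    imaginary axes if needed, x and y lie on opposite sides of a vertical line L.
    Local connectedness of P gives connected subsets U and V of P, around x and y
    and away from L, and three of the continua, A 0, A 1 and A 2, meet both U and
    V.  Together with the unbounded domain W, which comes close to every point of
    K, the sets U, V against A 0, A 1, A 2 make a drawing of K_{3,3}.

    The contradiction is combinatorial.  Connected sets are replaced by d-chains,
    finite sequences of points with steps shorter than d, and the winding number
    around q is replaced by the parity of the number of steps that cross the
    vertical ray above q.  For a closed chain in K this parity is 0 around far
    away points; it is locally constant off K, so it vanishes around every point
    of W once d is small.  By compactness of K a single d works for points of W
    close to every point of K (unlinked_near_boundary).

    Now let Q i be a chain through U, A i and V with ends independent of i, and
    let X i j count, modulo 2, the pairs made of a step of Q i and a step of Q j,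
    both across L, the second one above the first one.  When the first step is at
    a, the steps of Q j above it are those across the ray from a.  As a lies in
    A i, hence close to W but away from Q j and Q k, the closed chain formed by
    Q j and Q k does not wind around a, which gives X i j = X i k for distinct
    i, j, k.  On the other hand X i j + X j i counts all pairs of steps across L,
    and each chain crosses L an odd number of times, so X i j + X j i = 1.  Adding
    up the three equations X i j + X j i = 1, each X i j cancels against X i k,
    and 0 = 1 modulo 2 (no_three_crossings). *)

(** * Locally constant properties on connected sets *)

Lemma connected_locally_constant (X : topologicalType) (A : set X)
    (P : X -> Prop) x y :
  connected A ->
  (forall z, A z -> \forall w \near z, A w -> (P z <-> P w)) ->
  A x -> A y -> P x -> P y.
Proof.
move=> cA locP Ax Ay Px.
have AP : A `&` [set z | P z] = A.
  apply: cA; first by exists x.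
    exists (interior [set z | A z -> P z]); first exact: open_interior.
    apply/seteqP; split=> z [Az /=]; last by move/interior_subset/(_ Az).
    move=> Pz; split=> //; apply: filterS (locP _ Az) => w Pzw Aw; exact/Pzw.
  exists (~` interior [set z | A z -> ~ P z]).
    exact/open_closedC/open_interior.
  apply/seteqP; split=> z [Az /=].
    by move=> Pz; split=> // /interior_subset/(_ Az).
  move=> NPz; split=> //; apply: contrapT => nPz; apply: NPz.
  by apply: filterS (locP _ Az) => w Pzw Aw /(Pzw Aw).
by have := Ay; rewrite -AP => -[].
Qed.

(** * Chains and their crossings with vertical rays *)

(** The points of T are only seen through two coordinates f and g, so that the
    two axes of the complex plane can later be exchanged. *)
Section ChainCrossings.
Variables (R : realType) (T : topologicalType) (f g : T -> R).
Implicit Types (S K : set T) (x y z : T) (s : seq T) (e : T * T) (b c d r : R).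

Definition box r z w := (`|f z - f w| < r) && (`|g z - g w| < r).

Definition box_basis := forall x (U : set T),
  nbhs x U <-> exists2 r, 0 < r & forall w, box r x w -> U w.

Fixpoint chain S d x s : Prop :=
  S x /\ if s is y :: s' then box d x y /\ chain S d y s' else True.

(** The steps of the sequence that starts at x and continues with s. *)
Definition edges x s := zip (belast x s) s.

Definition straddles c e := (c < f e.1) (+) (c < f e.2).

(** The parity of the number of steps that cross the ray above (c, b).  A step
    is located by its origin alone: short steps that straddle c away from (c, b)
    pass above it or below it as a whole. *)
Definition crossings c b (E : seq (T * T)) :=
  \big[addb/false]_(e <- E) (straddles c e && (b < g e.1)).

(** Two chains with the same ends form a closed chain, so this says that closed
    d-chains in S wind an even number of times around (c, b). *)
Definition unlinked S d c b := forall x s s',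
  chain S d x s -> chain S d x s' -> last x s = last x s' ->
  crossings c b (edges x s) = crossings c b (edges x s').

(** The quantitative form of unshieldedness: the mesh d is uniform over K, and q
    is replaced by a nearby w because q itself may lie on the chains. *)
Definition nowhere_linked K := forall r, 0 < r ->
  exists2 d, 0 < d <= r & forall q, K q ->
    exists2 w, box r q w & unlinked K d (f w) (g w).

Definition far r c b z := (r <= `|f z - c|) || (r <= `|g z - b|).

Lemma chainS S S' d d' x s : S `<=` S' -> d <= d' ->
  chain S d x s -> chain S' d' x s.
Proof.
move=> SS' dd'; elim: s x => [|y s IHs] x /=; first by case=> /SS'.
move=> [/SS' S'x [/andP[bf bg] /IHs cs]]; split=> //; split=> //.
by apply/andP; split; apply: lt_le_trans dd'.
Qed.

Lemma chain_cat S d x s s' :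
  chain S d x s -> chain S d (last x s) s' -> chain S d x (s ++ s').
Proof.
elim: s x => [|y s IHs] x //= [Sx [bxy cs]] cs'.
by split=> //; split=> //; apply: IHs.
Qed.

Lemma chain_edges S d x s e : chain S d x s -> e \in edges x s ->
  [/\ S e.1, S e.2 & box d e.1 e.2].
Proof.
elim: s x => [|y s IHs] x //= [Sx [bxy cs]].
rewrite inE => /predU1P[->|/IHs]; last exact.
by split=> //; case: s cs {IHs} => [|? ?] [].
Qed.

Lemma unlinkedS S S' d d' c b : S' `<=` S -> d' <= d ->
  unlinked S d c b -> unlinked S' d' c b.
Proof. by move=> SS dd H x s s' cs cs'; apply: H; apply: chainS; eauto. Qed.

Lemma edges_telescope (F : T -> bool) x s :
  \big[addb/false]_(e <- edges x s) (F e.1 (+) F e.2) = F x (+) F (last x s).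
Proof.
elim: s x => [|y s IHs] x; first by rewrite big_nil addbb.
by rewrite big_cons IHs /= addbA -(addbA (F x)) addbb addbF.
Qed.

Lemma lt_neq_dist (x y c c' : R) :
  (c < x) != (c' < y) -> `|x - c| <= `|x - y| + `|c - c'|.
Proof.
have := ler_norm (x - y); have := ler_norm (- (x - y)); rewrite normrN.
have := ler_norm (c - c'); have := ler_norm (- (c - c')); rewrite normrN.
by case: ltP => h1; case: ltP => //= h2 *; rewrite ler_norml; apply/andP;
  split; lra.
Qed.

(** When the base of the ray moves a little, the contribution of a short step
    away from the base changes by a coboundary: the function F detects the points
    of the strip swept by the ray, and such a point is above or below both
    positions of the base. *)
Lemma straddles_edge_move d r r' c b c' b' e :
  d + r <= r' -> `|c - c'| < r -> `|b - b'| < r -> box d e.1 e.2 ->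
  far r' c b e.1 ->
  let F z := ((c < f z) (+) (c' < f z)) && (b < g z) in
  (straddles c e && (b < g e.1)) (+) (straddles c' e && (b' < g e.1)) =
  F e.1 (+) F e.2.
Proof.
case: e => z w /= dr cc bb /andP[fzw gzw] farz; rewrite /straddles /=.
have [same|diff] := boolP [&& (c < f z) == (c < f w),
    (c < f z) == (c' < f z) & (c < f z) == (c' < f w)].
  by case/and3P: same => /eqP<- /eqP<- /eqP<-; rewrite !addbb.
(* Otherwise the step is so close to the line f = c that it must be far above or
   far below the base of the ray. *)
have near_c : `|f z - c| < r'.
  have d0 : 0 < d := le_lt_trans (normr_ge0 _) fzw.
  have r0 : 0 < r := le_lt_trans (normr_ge0 _) cc.
  apply: lt_le_trans dr; move: diff; rewrite !negb_and.
  case/or3P=> /lt_neq_dist /le_lt_trans; apply;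
    rewrite ?subrr ?normr0 ?addr0 ?add0r.
  - exact: ltr_wpDr (ltW r0) fzw.
  - exact: ltr_wpDl (ltW d0) cc.
  - exact: ltrD.
have gz : r' <= `|g z - b| by case/orP: farz => //; rewrite leNgt near_c.
have -> : (b' < g z) = (b < g z).
  apply/esym/eqP; apply/negPn/negP => /lt_neq_dist /(le_trans gz).
  rewrite subrr normr0 add0r leNgt => /negP; apply.
  apply: (lt_le_trans bb); apply: le_trans dr.
  by rewrite lerDr (le_trans _ (ltW gzw)).
have -> : (b < g w) = (b < g z).
  apply/esym/eqP; apply/negPn/negP => /lt_neq_dist /(le_trans gz).
  rewrite subrr normr0 addr0 leNgt => /negP; apply.
  apply: (lt_le_trans gzw); apply: le_trans dr.
  by rewrite lerDl (le_trans _ (ltW cc)).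
by case: (c < f z); case: (c < f w); case: (c' < f z); case: (c' < f w);
  case: (b < g z).
Qed.

(** The winding parity is locally constant off the chain: the coboundaries of
    the preceding lemma telescope to terms at the ends, which are common to both
    chains. *)
Lemma unlinked_move S d r r' c b c' b' :
  d + r <= r' -> `|c - c'| < r -> `|b - b'| < r ->
  (forall z, S z -> far r' c b z) ->
  unlinked S d c b -> unlinked S d c' b'.
Proof.
move=> dr cc bb farS unl x s s' cs cs' eq_last.
have move_chain t : chain S d x t ->
    crossings c b (edges x t) (+) crossings c' b' (edges x t) =
    (((c < f x) (+) (c' < f x)) && (b < g x)) (+)
    (((c < f (last x t)) (+) (c' < f (last x t))) && (b < g (last x t))).
  move=> ct; rewrite -(edges_telescope
    (fun z => ((c < f z) (+) (c' < f z)) && (b < g z))).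
  rewrite -big_split; apply: eq_big_seq => e /(chain_edges ct)[S1 S2 box12].
  by apply: (straddles_edge_move dr) => //; apply: farS.
have := move_chain _ cs; have := move_chain _ cs'.
rewrite eq_last (unl _ _ _ cs cs' eq_last) => <- /addbI.
exact.
Qed.

(** Outside a large square the ray meets no step at all, except below the square,
    where it meets every step that straddles c; these telescope. *)
Lemma unlinked_outside S d c b M :
  (forall z, S z -> `|f z| <= M /\ `|g z| <= M) ->
  M < `|c| \/ M < `|b| -> unlinked S d c b.
Proof.
move=> bdS out x s s' cs cs' eq_last.
have bd e : S e.1 -> S e.2 ->
    [/\ - M <= f e.1 <= M, - M <= f e.2 <= M & - M <= g e.1 <= M].
  by rewrite -!ler_norml => /bdS[? ?] /bdS[].
case: out; rewrite ltr_normr => /orP[] lt.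
- rewrite /crossings !big1_seq// => e /andP[_ /chain_edges-/(_ _ _ _)];
  [move/(_ _ _ cs')|move/(_ _ _ cs)] =>
    [] [/bd H /H[/andP[_ h1] /andP[_ h2] _] _];
  by rewrite /straddles !ltNge !(le_trans _ (ltW lt)).
- rewrite /crossings !big1_seq// => e /andP[_ /chain_edges-/(_ _ _ _)];
  [move/(_ _ _ cs')|move/(_ _ _ cs)] =>
    [] [/bd H /H[/andP[h1 _] /andP[h2 _] _] _];
  by rewrite /straddles !(lt_le_trans _ h1) ?(lt_le_trans _ h2)// ltrNr.
- rewrite /crossings !big1_seq// => e /andP[_ /chain_edges-/(_ _ _ _)];
  [move/(_ _ _ cs')|move/(_ _ _ cs)] => [] [/bd H /H[_ _ /andP[_ h]] _];
  by rewrite (ltNge b) (le_trans h (ltW lt)) andbF.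
- have tele t : chain S d x t ->
      crossings c b (edges x t) = (c < f x) (+) (c < f (last x t)).
    move=> ct; rewrite -(edges_telescope (fun z => c < f z)).
    apply: eq_big_seq => e /(chain_edges ct)[/bd H /H[_ _ /andP[h _]] _].
    by rewrite (lt_le_trans _ h) ?andbT// ltrNr.
  by rewrite !tele// eq_last.
Qed.

(** * Linking with points of a domain and of its boundary *)

Hypothesis nbhs_boxP : box_basis.

Lemma connected_chain S d x y : connected S -> 0 < d -> S x -> S y ->
  exists2 s, chain S d x s & last x s = y.
Proof.
move=> cS d0 Sx Sy.
apply: (connected_locally_constant
  (P := fun y => exists2 s, chain S d x s & last x s = y) cS _ Sx Sy);
  last by exists [::].
move=> z Sz; apply/nbhs_boxP; exists d => // w bzw Sw.
split=> -[s cs ls]; [exists (s ++ [:: w])|exists (s ++ [:: z])];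
  rewrite ?last_cat//; apply: chain_cat => //; rewrite ls /=; split=> //; split=> //.
by move: bzw; rewrite /box distrC (distrC (g z)).
Qed.

(** The mesh d of the chains has to shrink with the distance from w to S, so d
    depends on w. *)
Lemma unlinked_connected S W w0 w d0 : closed S -> connected W -> W `<=` ~` S ->
  W w0 -> W w -> 0 < d0 -> unlinked S d0 (f w0) (g w0) ->
  exists2 d, 0 < d & unlinked S d (f w) (g w).
Proof.
move=> clS cW WS Ww0 Ww d00 unl0.
apply: (connected_locally_constant
  (P := fun w => exists2 d, 0 < d & unlinked S d (f w) (g w)) cW _ Ww0 Ww);
  last by exists d0.
move=> z /WS nSz.
have /nbhs_boxP[r r0 boxS] : nbhs z (~` S).
  by apply: open_nbhs_nbhs; split=> //; exact: closed_openC.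
have r30 : 0 < r / 3 by rewrite divr_gt0.
apply/nbhs_boxP; exists (r / 3) => // z' /andP[bf bg] _.
have farz y : S y -> far r (f z) (g z) y.
  move=> Sy; rewrite /far !leNgt -negb_and; apply/negP => bzy.
  by apply: (boxS y) => //; move: bzy; rewrite /box distrC (distrC (g y)).
have farz' y : S y -> far (r / 3 + r / 3) (f z') (g z') y.
  move=> /farz; rewrite /far => /orP[h|h]; apply/orP; [left|right].
    by have := ler_distD (f z') (f y) (f z); rewrite (distrC (f z')) => ?; lra.
  by have := ler_distD (g z') (g y) (g z); rewrite (distrC (g z')) => ?; lra.
have min0 d : 0 < d -> 0 < Num.min d (r / 3) by move=> d1; rewrite lt_min d1.
split=> -[d d1 unl]; exists (Num.min d (r / 3)); rewrite ?min0//.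
  apply: (unlinked_move (r := r / 3) (r' := r)) farz _ => //.
    by rewrite (@le_trans _ _ (r / 3 + r / 3))// ?lerD2r ?ge_min ?lexx ?orbT//;
      lra.
  by apply: unlinkedS unl => //; rewrite ge_min lexx.
apply: (unlinked_move (r := r / 3) (r' := r / 3 + r / 3)) farz' _;
  rewrite 1?distrC//.
  by rewrite lerD2r ge_min lexx orbT.
by apply: unlinkedS unl => //; rewrite ge_min lexx.
Qed.

(** A single mesh d is obtained from finitely many points of W, one near each
    point of a finite net of K. *)
Lemma unlinked_uniform K W : compact K -> K `<=` closure W ->
  (forall w, W w -> exists2 d, 0 < d & unlinked K d (f w) (g w)) ->
  nowhere_linked K.
Proof.
move=> cK KW unlW r r0.
have : \forall d \near 0^'+,
    K `<=` [set q | exists2 w, box r q w & unlinked K d (f w) (g w)].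
  move/compact_near_coveringP : cK; apply=> q Kq.
  have r20 : 0 < r / 2 by rewrite divr_gt0.
  have [w [Ww /andP[fqw gqw]]] : exists w, W w /\ box (r / 2) q w.
    have [|w []] := KW _ Kq [set w | box (r / 2) q w].
      by apply/nbhs_boxP; exists (r / 2).
    by move=> ? ?; exists w.
  have [d0 d00 unl] := unlW _ Ww.
  exists ([set q' | box (r / 2) q q'], [set d | d < d0]).
    split; first by apply/nbhs_boxP; exists (r / 2).
    exact: nbhs_right_lt.
  case=> q' d /= [/andP[fqq gqq] dd0]; exists w.
    rewrite /box; apply/andP; split.
      by have := ler_distD (f q) (f q') (f w);
        rewrite (distrC (f q') (f q)) => ?; lra.
    by have := ler_distD (g q) (g q') (g w);
      rewrite (distrC (g q') (g q)) => ?; lra.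
  by apply: unlinkedS unl => //; exact: ltW.
move=> near_unl.
have [d [[d0 dr] unl]] : exists d, (0 < d /\ d <= r) /\
    K `<=` [set q | exists2 w, box r q w & unlinked K d (f w) (g w)].
  apply: (@filter_ex _ (0 : R)^'+).
  near=> d; split; first split; near: d => //.
    exact: nbhs_right_gt.
  exact: nbhs_right_le.
by exists d; first exact/andP.
Unshelve. all: by end_near. Qed.

Lemma compact_box_bounded K : compact K ->
  exists M, forall z, K z -> `|f z| <= M /\ `|g z| <= M.
Proof.
move=> cK.
have : \forall M \near +oo, K `<=` [set z | `|f z| <= M /\ `|g z| <= M].
  move/compact_near_coveringP : cK; apply=> q Kq.
  exists ([set q' | box 1 q q'], [set M | `|f q| + `|g q| + 1 <= M]).
    split; first by apply/nbhs_boxP; exists 1.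
    exact: nbhs_pinfty_ge.
  case=> q' M /= [/andP[f1 g1] leM].
  have := lerB_dist (f q') (f q); rewrite distrC => hf.
  have := lerB_dist (g q') (g q); rewrite distrC => hg.
  have := normr_ge0 (f q); have := normr_ge0 (g q); split; lra.
by move=> /filter_ex[M HM]; exists M.
Qed.

(** Closed chains in K do not wind around a point of W far from K, hence around
    no point of the connected set W; and W accumulates on all of K. *)
Lemma unlinked_near_boundary K W : compact K -> closed K -> connected W ->
  W `<=` ~` K -> K `<=` closure W ->
  (forall M, exists2 w, W w & M < `|f w| \/ M < `|g w|) ->
  nowhere_linked K.
Proof.
move=> cK clK cW WK KW unbW; apply: (unlinked_uniform cK KW) => w Ww.
have [M KM] := compact_box_bounded cK; have [w0 Ww0 w0M] := unbW M.
exact: (unlinked_connected clK cW WK Ww0 Ww ltr01 (unlinked_outside KM w0M)).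
Qed.

(** * The crossing argument *)

(** The topological K_{3,3}: U, V and the surroundings of K on one side, the
    three sets A i on the other.  The line f = c separates u from v and stays
    away from U and V, so a chain through U, A i and V crosses it only in A i. *)
Lemma no_three_crossings K U V (A : 'I_3 -> set T) c r u v :
  nowhere_linked K ->
  connected U -> connected V -> (forall i, connected (A i)) ->
  U `<=` K -> V `<=` K -> (forall i, A i `<=` K) ->
  (forall i, A i `&` U !=set0) -> (forall i, A i `&` V !=set0) ->
  0 < r -> (forall z, U z \/ V z -> r <= `|f z - c|) ->
  (forall i j, i != j -> forall z w, A i z -> A j w -> ~~ box r z w) ->
  U u -> V v -> (c < f u) != (c < f v) -> False.
Proof.
move=> accK cU cV cA UK VK AK AU AV r0 farUV sepA Uu Vv uv.
(* A step of Q i across the line is within r / 8 of the line, and within r / 8 of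
   a point that no fine closed chain winds around; this leaves enough of r to go
   from one to the other without meeting Q j and Q k. *)
have r80 : 0 < r / 8 by rewrite divr_gt0.
have [d /andP[d0 dr] acc] := accK _ r80.
pose S i := U `|` A i `|` V.
have exQ i : exists s, chain (S i) d u s /\ last u s = v.
  have [a [Aa Ua]] := AU i; have [b [Ab Vb]] := AV i.
  have [s1 c1 l1] := connected_chain cU d0 Uu Ua.
  have [s2 c2 l2] := connected_chain (cA i) d0 Aa Ab.
  have [s3 c3 l3] := connected_chain cV d0 Vb Vv.
  exists (s1 ++ s2 ++ s3); rewrite !last_cat l1 l2; split=> //.
  apply: chain_cat; first by apply: chainS c1 => // z Uz; left; left.
  rewrite l1; apply: chain_cat.
    by apply: chainS c2 => // z Az; left; right.
  by rewrite l2; apply: chainS c3 => // z Vz; right.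
have [Q QP] := choice exQ.
have mid i e : e \in edges u (Q i) -> straddles c e ->
    A i e.1 /\ `|f e.1 - c| < d.
  move=> /(chain_edges (proj1 (QP i)))[S1 S2 /andP[fe _]] str.
  have near_c : `|f e.1 - c| < d.
    have /lt_neq_dist : (c < f e.1) != (c < f e.2).
      by move: str; rewrite /straddles; do 2 case: ltP.
    by rewrite subrr normr0 addr0 => /le_lt_trans; apply.
  split=> //; have dr' : d < r by lra.
  have notUV : ~ (U e.1 \/ V e.1).
    by move/farUV; rewrite leNgt (lt_trans near_c dr').
  by case: S1 => [[UV|]|UV] //; case: notUV; [left|right].
pose X i j := \big[addb/false]_(e <- edges u (Q i))
  (straddles c e && crossings c (g e.1) (edges u (Q j))).
(* Any two crossings of the line by Q i and Q j are at different heights, so one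
   is above the other: X i j + X j i counts all pairs of crossings. *)
have X_sym i j : i != j -> X i j (+) X j i.
  move=> ij.
  have X2 i' j' : X i' j' = \big[addb/false]_(e <- edges u (Q i'))
      \big[addb/false]_(e' <- edges u (Q j'))
        (straddles c e && (straddles c e' && (g e.1 < g e'.1))).
    by apply: eq_bigr => e _; rewrite big_distrr.
  rewrite (X2 i j) (X2 j i) [X in _ (+) X]exchange_big -big_split /=.
  under eq_bigr do rewrite -big_split /=.
  transitivity (\big[addb/false]_(e <- edges u (Q i))
      \big[addb/false]_(e' <- edges u (Q j))
        (straddles c e && straddles c e')); last first.
    (* Both factors telescope to the two sides of u and v. *)
    rewrite -big_distrlr /= !(edges_telescope (fun z => c < f z)).
    by rewrite !(proj2 (QP _)); move: uv; do 2 case: (c < _).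
  apply: eq_big_seq => e ei; apply: eq_big_seq => e' ej.
  have [se|] := boolP (straddles c e); last by rewrite /= andbF.
  have [se'|] := boolP (straddles c e'); last by [].
  have [Ae he] := mid _ _ ei se; have [Ae' he'] := mid _ _ ej se'.
  rewrite /=; case: ltgtP => // geq; exfalso.
  have := sepA _ _ ij _ _ Ae Ae'.
  rewrite /box geq subrr normr0 r0 andbT => /negP; apply.
  by have := ler_distD c (f e.1) (f e'.1); rewrite (distrC c) => ?; lra.
(* The crossings of Q i with the line are in A i, close to points of the plane
   around which Q j followed by Q k backwards does not wind. *)
have X_const i j k : j != i -> k != i -> X i j = X i k.
  move=> ji ki; apply: eq_big_seq => e ei.
  have [se|//] := boolP (straddles c e).
  have [Ae he] := mid _ _ ei se; rewrite /=.
  have [w /andP[fw gw] unlw] := acc _ (AK _ _ Ae).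
  have SK : S j `|` S k `<=` K.
    by move=> z [] [[/UK|/AK]|/VK].
  have unl : unlinked (S j `|` S k) d c (g e.1).
    apply: (unlinked_move (r := r / 2) (r' := r * 3 / 4) _ _ _ _
      (unlinkedS SK (lexx d) unlw)).
    - lra.
    - by have := ler_distD (f e.1) (f w) c; rewrite (distrC _ (f e.1)) => ?; lra.
    - rewrite distrC; lra.
    have farA z l : l != i -> A l z ->
        r <= `|f e.1 - f z| \/ r <= `|g e.1 - g z|.
      rewrite eq_sym => /sepA-/(_ _ _ Ae) H /H.
      by rewrite /box negb_and -!leNgt => /orP[]; [left|right].
    have farw z :
        (U z \/ V z) \/ (r <= `|f e.1 - f z| \/ r <= `|g e.1 - g z|) ->
        far (r * 3 / 4) (f w) (g w) z.
      have fwz := ler_distD (f w) (f e.1) (f z).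
      have gwz := ler_distD (g w) (g e.1) (g z).
      have fzc := ler_distD (f w) (f z) c.
      have fwc := ler_distD (f e.1) (f w) c.
      rewrite /far (distrC (f z)) (distrC (g z)).
      rewrite (distrC (f z) (f w)) in fzc.
      rewrite (distrC (f w) (f e.1)) in fwc.
      by move=> [/farUV zc|[zf|zg]]; apply/orP; [left|left|right]; lra.
    move=> z Sz; apply: farw.
    by case: Sz => [] [[Uz|Az]|Vz]; do ?[by left; left|by left; right];
      right; exact: farA Az.
  apply: unl; first by apply: chainS (proj1 (QP j)) => // z; left.
    by apply: chainS (proj1 (QP k)) => // z; right.
  by rewrite !(proj2 (QP _)).
pose i0 : 'I_3 := ord0; pose i1 : 'I_3 := inord 1; pose i2 : 'I_3 := ord_max.
have n10 : i1 != i0 by rewrite -val_eqE /= inordK.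
have n20 : i2 != i0 by [].
have n21 : i2 != i1 by rewrite -val_eqE /= inordK.
have := X_sym _ _ n10; have := X_sym _ _ n20; have := X_sym _ _ n21.
rewrite (X_const i0 i1 i2)// (X_const i1 i0 i2)// 1?eq_sym//.
rewrite (X_const i2 i0 i1)// 1?eq_sym//.
by case: (X i0 i2); case: (X i1 i2); case: (X i2 i1).
Qed.

Lemma disjoint_compact_separated (A B : set T) :
  compact A -> closed B -> A `&` B = set0 ->
  \forall r \near 0^'+, forall z w, A z -> B w -> ~~ box r z w.
Proof.
move=> cA clB AB0.
have : \forall r \near 0^'+, A `<=` [set z | forall w, B w -> ~~ box r z w].
  move/compact_near_coveringP : cA; apply=> z Az.
  have /nbhs_boxP[r r0 boxB] : nbhs z (~` B).
    apply: open_nbhs_nbhs; split; first exact: closed_openC.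
    by move=> Bz; have : (A `&` B) z by []; rewrite AB0.
  have r20 : 0 < r / 2 by rewrite divr_gt0.
  exists ([set z' | box (r / 2) z z'], [set d | d < r / 2]).
    split; first by apply/nbhs_boxP; exists (r / 2).
    exact: nbhs_right_lt.
  case=> z' d /= [/andP[f1 g1] dr] w Bw; apply/negP => /andP[f2 g2].
  apply: (boxB w) => //; apply/andP; split.
    by have := ler_distD (f z') (f z) (f w) => ?; lra.
  by have := ler_distD (g z') (g z) (g w) => ?; lra.
by apply: filterS => r H z w Az; exact: H.
Qed.

End ChainCrossings.

(** * The complex plane *)

Section ComplexPlane.
Variable R : realType.
Local Notation Re := (@complex.Re R : Cplx R -> R).
Local Notation Im := (@complex.Im R : Cplx R -> R).
Local Notation normc := (@Normc.normc R).
Implicit Types (z w : Cplx R) (K P W : set (Cplx R)).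

Lemma ge_normc_Re z : `|Re z| <= normc z.
Proof.
case: z => a b /=; rewrite -sqrtr_sqr ler_sqrt ?lerDl ?sqr_ge0//.
by rewrite addr_ge0 ?sqr_ge0.
Qed.

Lemma ge_normc_Im z : `|Im z| <= normc z.
Proof.
case: z => a b /=; rewrite -sqrtr_sqr ler_sqrt ?lerDr ?sqr_ge0//.
by rewrite addr_ge0 ?sqr_ge0.
Qed.

Lemma normc_le z : normc z <= `|Re z| + `|Im z|.
Proof.
case: z => a b /=; rewrite -[leRHS]ger0_norm ?addr_ge0// -sqrtr_sqr.
rewrite ler_sqrt ?sqr_ge0//.
by rewrite sqrrD !real_normK ?num_real// addrAC lerDl mulrn_wge0// mulr_ge0.
Qed.

Lemma normCplxE z : `|z| = (normc z)%:C%C :> Cplx R.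
Proof. by []. Qed.

Lemma box_basis_Re_Im : box_basis Re Im.
Proof.
move=> x U; split.
  move/nbhs_ballP => [[e e'] /=]; rewrite ltcE /= => /andP[/eqP-> e0] ballU.
  exists (e / 2); first by rewrite divr_gt0.
  move=> w /andP[fxw gxw]; apply: ballU; rewrite -ball_normE /= normCplxE ltcR.
  apply: le_lt_trans (normc_le _) _.
  rewrite [ltRHS](splitr e); apply: ltrD.
    by move: fxw; rewrite raddfB.
  by move: gxw; rewrite raddfB.
move=> [r r0 boxU]; apply/nbhs_ballP; exists (r%:C)%C => /=.
  by rewrite ltcR.
move=> w; rewrite -ball_normE /= normCplxE ltcR => lt; apply: boxU.
rewrite /box -!raddfB /= (le_lt_trans (ge_normc_Re _) lt).
by rewrite (le_lt_trans (ge_normc_Im _) lt).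
Qed.

Lemma box_basis_Im_Re : box_basis Im Re.
Proof.
move=> x U.
split=> [/box_basis_Re_Im[r r0 H]|[r r0 H]]; [|apply/box_basis_Re_Im];
  by exists r => // w; rewrite /box andbC => /H.
Qed.

Lemma unbounded_Re_Im W M : ~ bounded_set W ->
  exists2 w, W w & M < `|Re w| \/ M < `|Im w|.
Proof.
move=> unbW; apply: contrapT => bdW; apply: unbW.
exists ((M + M)%:C)%C; split; first by rewrite complex_real.
move=> B MB w Ww /=; rewrite normCplxE; apply: le_trans (ltW MB).
rewrite lecR; apply: le_trans (normc_le _) _.
by apply: lerD; rewrite leNgt; apply/negP => lt; apply: bdW; exists w => //;
  [left|right].
Qed.

(** Infinitely many of the disjoint continua come close to both x and y; within P
    they can be joined near x, and near y, by connected sets that the line half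
    way between x and y avoids, which makes three of them a forbidden triple. *)
Lemma disjoint_sequence_not_clustering K P (A : nat -> set (Cplx R))
    (f g : Cplx R -> R) x y :
  box_basis f g -> nowhere_linked f g K ->
  P `<=` K -> locally_connected P -> P x -> P y -> f x != f y ->
  (forall n, continuum (A n) /\ A n `<=` P) ->
  (forall m n, m <> n -> A m `&` A n = set0) ->
  (forall U V m, nbhs x U -> nbhs y V ->
    exists n, [/\ (m <= n)%N, A n `&` U !=set0 & A n `&` V !=set0]) ->
  False.
Proof.
move=> boxP unlK PK lcP Px Py fxy AP disjA clusA.
pose c := (f x + f y) / 2; pose h := `|f x - f y| / 4.
have h0 : 0 < h by rewrite divr_gt0// normr_gt0 subr_eq0.
have nbhs_h z : nbhs z [set w | `|f z - f w| < h].
  by apply/boxP; exists h => // w /andP[].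
have [U [oU Ux PU cU]] := lcP _ _ Px (nbhs_h x).
have [V [oV Vy PV cV]] := lcP _ _ Py (nbhs_h y).
have nbU : nbhs x U by apply: open_nbhs_nbhs.
have nbV : nbhs y V by apply: open_nbhs_nbhs.
have [n0 [_ U0 V0]] := clusA _ _ 0%N nbU nbV.
have [n1 [n01 U1 V1]] := clusA _ _ n0.+1 nbU nbV.
have [n2 [n12 U2 V2]] := clusA _ _ n1.+1 nbU nbV.
pose n (i : 'I_3) := nth 0%N [:: n0; n1; n2] i.
have n_inj i j : i != j -> n i <> n j.
  move=> /eqP ij eq_n; apply: ij; apply: val_inj; move: eq_n; rewrite /n.
  case: i => [[|[|[|]]]]//= _; case: j => [[|[|[|]]]]//= _ eq_n //;
    move: n01 n12; rewrite eq_n ?ltnn// => n01 n12;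
    by move: (ltn_trans n01 n12); rewrite ?eq_n ltnn.
have nUV i : A (n i) `&` U !=set0 /\ A (n i) `&` V !=set0.
  by rewrite /n; case: i => [[|[|[|]]]].
have [r [[r0 rh] sep]] : exists r, (0 < r /\ r <= h) /\
    forall i j, i != j -> forall z w, A (n i) z -> A (n j) w ->
      ~~ box f g r z w.
  apply: (@filter_ex _ (0 : R)^'+).
  near=> r; split.
    by split; near: r; [exact: nbhs_right_gt|exact: nbhs_right_le].
  near: r; apply: filter_forall => i; apply: filter_forall => j.
  have [->|ij] := eqVneq i j; first by apply: nearW => r /eqP.
  have clA : closed (A (n j)).
    by apply: compact_closed; [exact: norm_hausdorff|exact: (AP (n j)).1.1].
  have := disjoint_compact_separated boxP (AP (n i)).1.1 clA
    (disjA _ _ (n_inj _ _ ij)).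
  by apply: filterS => r H _.
have [c1 c2] : f x - c = (f x - f y) / 2 /\ f y - c = - ((f x - f y) / 2).
  by rewrite /c; split; lra.
have fxc : `|f x - c| = h + h.
  by rewrite c1 normrM (ger0_norm (x := 2^-1))// /h; lra.
have fyc : `|f y - c| = h + h.
  by rewrite c2 normrN normrM (ger0_norm (x := 2^-1))// /h; lra.
apply: (no_three_crossings (f := f) (g := g) boxP (K := K) (U := P `&` U)
  (V := P `&` V) (A := A \o n) (c := c) (r := r) (u := x) (v := y)) => //=.
- by move=> i; exact: (AP (n i)).1.2.
- by move=> z [/PK].
- by move=> z [/PK].
- by move=> i; apply: subset_trans PK; exact: (AP (n i)).2.
- move=> i; have [[z [Az Uz]] _] := nUV i; exists z.
  by do !split => //; exact: (AP (n i)).2.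
- move=> i; have [_ [z [Az Vz]]] := nUV i; exists z.
  by do !split => //; exact: (AP (n i)).2.
- move=> z []; [move/PU|move/PV] => /= lt; apply: (le_trans rh);
    rewrite -(lerD2l h).
    by rewrite -fxc (le_trans (ler_distD (f z) _ _))// lerD2r ltW.
  by rewrite -fyc (le_trans (ler_distD (f z) _ _))// lerD2r ltW.
- have : c - f x = - (c - f y) by rewrite /c; lra.
  have /eqP : f x - f y != 0 by rewrite subr_eq0.
  by case: (ltP c (f x)); case: (ltP c (f y)) => //= *; lra.
Unshelve. all: by end_near. Qed.

Lemma diam_ge_dist (A : set (Cplx R)) (e : R) :
  (e%:E <= diam A)%E -> 0 < e ->
  exists p : Cplx R * Cplx R, [/\ A p.1, A p.2 & e / 2 <= normc (p.1 - p.2)].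
Proof.
move=> dA e0; have : ((e / 2)%:E < diam A)%E.
  by apply: lt_le_trans dA; rewrite lte_fin; lra.
move=> /ereal_sup_gt[_ [p [Ap1 Ap2] <-]]; rewrite lte_fin => /ltW le.
by exists p.
Qed.

(** The pairs of distant points of the sets A n cluster at (x, y), and the lower
    bound on their distances is what keeps x apart from y. *)
Lemma sequence_clusters P (A : nat -> set (Cplx R)) e : compact P -> 0 < e ->
  (forall n, A n `<=` P) -> (forall n, (e%:E <= diam (A n))%E) ->
  exists x y, [/\ P x, P y, x != y & forall U V m, nbhs x U -> nbhs y V ->
    exists n, [/\ (m <= n)%N, A n `&` U !=set0 & A n `&` V !=set0]].
Proof.
move=> cP e0 AP dA.
have [p pA] := choice (fun n => diam_ge_dist (dA n) e0).
have pP : (p @ \oo) (P `*` P).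
  by exists 0%N => // n _ /=; have [/AP ? /AP ? _] := pA n.
have [[x y] [[/= Px Py] clu]] := compact_setX cP cP (fmap_proper_filter p _) pP.
have clus U V m : nbhs x U -> nbhs y V ->
    exists n, [/\ (m <= n)%N, U (p n).1 & V (p n).2].
  move=> nU nV.
  have tail_m : (p @ \oo) (p @` [set n | (m <= n)%N]).
    by exists m => // n /= mn; exists n.
  have nUV : nbhs (x, y) (U `*` V) by exists (U, V).
  by have [q [[n /= mn <-] [Un Vn]]] := clu _ _ tail_m nUV; exists n.
exists x, y; split=> //; last first.
  move=> U V m nU nV; have [n [mn Un Vn]] := clus U V m nU nV.
  have [A1 A2 _] := pA n; exists n.
  by split => //; [exists (p n).1|exists (p n).2].
apply/eqP => xy; rewrite -xy in clus.
have e80 : 0 < e / 8 by rewrite divr_gt0.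
have nbB : nbhs x [set w | box Re Im (e / 8) x w].
  by apply/box_basis_Re_Im; exists (e / 8).
have [n [_ /= /andP[f1 g1] /andP[f2 g2]]] := clus _ _ 0%N nbB nbB.
have [_ _] := pA n; apply/negP; rewrite -ltNge.
apply: le_lt_trans (normc_le _) _.
have -> : e / 2 = (e / 8 + e / 8) + (e / 8 + e / 8) by lra.
rewrite (raddfB Re) (raddfB Im).
by apply: ltrD; [apply: le_lt_trans (ler_distD (Re x) _ _) _
  |apply: le_lt_trans (ler_distD (Im x) _ _) _]; rewrite ltrD// distrC.
Qed.

Lemma unshielded_nowhere_linked K : unshielded K ->
  nowhere_linked Re Im K /\ nowhere_linked Im Re K.
Proof.
move=> [cK [W [[w0 _ <-] unbW KW]]].
set W0 := connected_component _ _ in unbW KW.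
have clK : closed K by apply: compact_closed => //; exact: norm_hausdorff.
have cW : connected W0 by exact: component_connected.
have WK : W0 `<=` ~` K by exact: connected_component_sub.
have Kcl : K `<=` closure W0 by rewrite KW => z [].
split; apply: (unlinked_near_boundary _ cK clK cW WK Kcl).
- exact: box_basis_Re_Im.
- by move=> M; exact: unbounded_Re_Im.
- exact: box_basis_Im_Re.
- move=> M; have [w Ww H] := unbounded_Re_Im M unbW.
  by exists w => //; rewrite or_comm.
Qed.

(** The absence of winding concerns all closed chains in K, in particular those
    in P, so the unshieldedness of K can be used while P provides the local
    connectedness. *)
Lemma finite_disjoint_continua K P (F : set (set (Cplx R))) e :
  unshielded K -> P `<=` K -> peano_continuum P -> 0 < e ->
  (forall A, F A -> continuum A /\ A `<=` P) ->
  (forall A B, F A -> F B -> A <> B -> A `&` B = set0) ->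
  (forall A, F A -> (e%:E <= diam A)%E) -> finite_set F.
Proof.
move=> unsK PK [[cP _] lcP] e0 FP disjF dF.
apply: contrapT => /infiniteP/pcard_leP/injfunPex[/= A AF Ainj].
have {}AF n : F (A n) by exact: AF.
have disjA m n : m <> n -> A m `&` A n = set0.
  by move=> mn; apply: disjF => // eqA; apply: mn; apply: Ainj; rewrite ?inE.
have AP n := FP _ (AF n).
have [x [y [Px Py xy clusA]]] :=
  sequence_clusters cP e0 (fun n => (AP n).2) (fun n => dF _ (AF n)).
have [unlRe unlIm] := unshielded_nowhere_linked unsK.
have [eqRe|neqRe] := eqVneq (Re x) (Re y); last first.
  exact: (disjoint_sequence_not_clustering box_basis_Re_Im unlRe PK lcP Px Py
    neqRe AP disjA clusA).
have neqIm : Im x != Im y.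
  apply: contra xy => /eqP eqIm; move: eqRe eqIm.
  by case: (x) => a b; case: (y) => a' b' /= -> ->.
exact: (disjoint_sequence_not_clustering box_basis_Im_Re unlIm PK lcP Px Py
  neqIm AP disjA clusA).
Qed.
End ComplexPlane.

Theorem theorem2p1 (R : realType) (K : set (Cplx R)) :
  unshielded K -> peano_compactum K -> finitely_suslinian K.
Proof.
move=> unsK [cK peanoK finK]; split=> // F FK disjF [e e0 dF].
have -> : F = \bigcup_(P in [set P | component_of K P /\ ~ (diam P < e%:E)%E])
    (F `&` [set A | A `<=` P]).
  apply/seteqP; split=> [A FA|A [P _ []]//].
  have [[cA conA] AK] := FK _ FA.
  have [[p _] [/= Ap _ _]] := diam_ge_dist (dF _ FA) e0.
  have AP : A `<=` connected_component K p by exact: connected_component_max.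
  exists (connected_component K p) => //; split.
    by exists p => //; exact: AK.
  apply/negP; rewrite -leNgt; apply: le_trans (dF _ FA) _; apply: ereal_sup_le.
  by move=> _ [q [q1 q2] <-]; exists q => //; split; exact: AP.
apply: bigcup_finite => [|P [KP _]]; first exact: finK.
have PK : P `<=` K by case: KP => p _ <-; exact: connected_component_sub.
apply: (finite_disjoint_continua unsK PK (peanoK _ KP) e0).
- by move=> A [/FK[cA _] AP].
- by move=> A B [FA _] [FB _]; exact: disjF.
- by move=> A [FA _]; exact: dF.
Qed.
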